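(* Let $n\in\mathbb{N}$, let $\alpha_i>0$ and $x_i>0$ ($i=1,\ldots,n$) be real numbers with $\sum_{i=1}^n\alpha_i=1$, and suppose that the $x_i$ are not all equal. Let $$h=\Big(\sum_{i=1}^n\frac{\alpha_i}{x_i}\Big)^{-1},\qquad g=\prod_{i=1}^n x_i^{\alpha_i},\qquad a=\sum_{i=1}^n\alpha_i x_i,\qquad \alpha=\min_i\{\alpha_i\}.$$ Then $\alpha\le 1/n$ and $$g\le\left(\frac{a-h(1-2\alpha)-\sqrt{(a-h)(a-h(1-2\alpha)^2)}}{2\alpha}\right)^{\alpha}\left(\frac{a+h(1-2\alpha)+\sqrt{(a-h)(a-h(1-2\alpha)^2)}}{2(1-\alpha)}\right)^{1-\alpha},$$ $$g\ge\left(\frac{a-h(1-2\alpha)+\sqrt{(a-h)(a-h(1-2\alpha)^2)}}{2\alpha}\right)^{\alpha}\left(\frac{a+h(1-2\alpha)-\sqrt{(a-h)(a-h(1-2\alpha)^2)}}{2(1-\alpha)}\right)^{1-\alpha}.$$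
   Context: The quantities $h$, $g$, $a$ are the weighted harmonic, geometric and arithmetic means of the $x_i$ with weights $\alpha_i$. Since the $x_i$ are not all equal, $n\ge 2$. *)

(* Defs.v *)
From HB Require Import structures.
From mathcomp Require Export all_boot all_order all_algebra.
From mathcomp Require Export all_classical all_reals all_analysis.

Set Implicit Arguments.
Unset Strict Implicit.
Unset Printing Implicit Defensive.

Import Order.TTheory GRing.Theory Num.Theory.

Local Open Scope ring_scope.

Definition is_min (R : realType) (n : nat) (u : 'I_n -> R) (m : R) : Prop :=
  (exists i, u i = m) /\ (forall i, m <= u i).

(* Main.v *)
Require Import Defs.
From mathcomp Require Import all_boot all_order all_algebra.
From mathcomp Require Import all_classical all_reals all_analysis.
From mathcomp Require Import ring lra.

Set Implicit Arguments.
Unset Strict Implicit.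
Unset Printing Implicit Defensive.

Import Order.TTheory GRing.Theory Num.Theory.
Import numFieldNormedType.Exports.

Local Open Scope ring_scope.

(** Write [E] for the mean with weights [w]. Only [E x = a] and [E (1/x) = 1/h]
enter the two bounds, and each bound is [exp (E ln y)] for a variable [y] with
these same two moments that takes a value [u] with probability [alpha] and a
value [v] with probability [1 - alpha]. There are two such variables, one with
[u < v] and one with [v < u].

The comparison of [E ln x] with [E ln y] is by duality: choose [A], [B], [C] so
that [P t = A + B t + C / t] agrees with [ln] at [u] and is tangent to it at
[v]. As [P] is integrated exactly by the two moments, [E (P x) = E (P y)], and
this is [E ln y] because [P = ln] at both values of [y]. The difference
[ln - P] vanishes twice at [v] and once at [u], and changes sign only at [u]:
[ln <= P] to the right of [u] and [ln >= P] to the left. After rescaling to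
[v = 1] this says that the function [ln_ratio] below is nonincreasing
([ln_ratio_nincr]); the consequence for means is [sum_ln_le_two_point] and
[sum_ln_ge_two_point].

It remains to see that every [x i] lies between the two possible values of [u],
and this is where the minimal weight matters: a value [t] carried by a weight
at least [alpha] cannot be far out. The Cauchy-Schwarz inequality for the other
values bounds [w i * (t / h + a / t - 2)] by [a / h - 1]
([value_dispersion_le]). The bracket is nonnegative, so [alpha] may replace
[w i], and the result is a quadratic inequality in [t] whose roots are the two
values of [u] ([value_between_roots]). *)

(** * Interpolating the logarithm *)

Lemma ge0_is_derive_le (R : realType) (f df : R -> R) (a b : R) : a <= b ->
  (forall z, a <= z <= b -> is_derive z 1 f (df z)) ->
  (forall z, a <= z <= b -> 0 <= df z) -> f a <= f b.
Proof.
move=> ab fdf df0.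
have fder z : z \in `]a, b[ -> is_derive z 1 f (df z).
  by rewrite in_itv /= => /andP[az zb]; apply: fdf; rewrite !ltW.
have fc : {within `[a, b], continuous f}%classic.
  apply: derivable_within_continuous => z; rewrite in_itv /= => /fdf fz.
  exact: ex_derive.
have [c] := MVT_segment ab fder fc.
rewrite in_itv /= => /df0 dc0 fab.
by rewrite -subr_ge0 fab mulr_ge0 // subr_ge0.
Qed.

(** The derivative is [1/z - 1 - ln (1/z)], nonnegative by [ln (1 + y) <= y].
The function vanishes at 1, so its sign is that of [z - 1]: this is the
comparison of [ln] with its Pade approximant [2 (z - 1) / (z + 1)], and it
gives the sign of the derivative of [ln_ratio]. *)
Lemma pade_ln_ndecr (R : realType) (x y : R) : 0 < x -> x <= y ->
  (x + 1) * ln x - 2 * (x - 1) <= (y + 1) * ln y - 2 * (y - 1).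
Proof.
move=> x0 xy.
pose df z : R := z^-1 - 1 - ln z^-1.
apply: (ge0_is_derive_le (f := fun z => (z + 1) * ln z - 2 * (z - 1))
  (df := df) xy) => z /andP[xz _].
- have z0 : 0 < z := lt_le_trans x0 xz.
  have dln := is_derive1_ln z0.
  apply: is_derive_eq.
  rewrite /df lnV ?posrE // /GRing.scale /=.
  by field; rewrite gt_eqF.
- have z0 : 0 < z^-1 by rewrite invr_gt0 (lt_le_trans x0 xz).
  have := @le_ln1Dx R (z^-1 - 1); rewrite addrCA subrr addr0 /df => /(_ _) h.
  by rewrite subr_ge0; apply: h; lra.
Qed.

(** The derivative is [(1 - 1/z)^2]. As the function vanishes at 1, it has the
sign of [z - 1]; this locates [ln_ratio] with respect to [-1/2]. *)
Lemma ln_sub_inv_ndecr (R : realType) (x y : R) : 0 < x -> x <= y ->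
  x - x^-1 - 2 * ln x <= y - y^-1 - 2 * ln y.
Proof.
move=> x0 xy.
apply: (ge0_is_derive_le (f := fun z => z - z^-1 - 2 * ln z)
  (df := fun z => (1 - z^-1) ^+ 2) xy) => z /andP[xz _].
- have z0 : 0 < z := lt_le_trans x0 xz.
  have dln := is_derive1_ln z0.
  have dV : is_derive z 1 (fun y : R => y^-1) (- z ^- 2 *: 1).
    by apply: is_deriveV; rewrite gt_eqF.
  apply: is_derive_eq.
  rewrite /GRing.scale /=.
  by field; rewrite gt_eqF.
- exact: sqr_ge0.
Qed.

(** The coefficient [C] for which [t - 1 + C (t + 1/t - 2)], the interpolant in
the span of [1], [t] and [1/t] that is tangent to [ln] at 1, also agrees with
[ln] at [x]. It has a removable singularity at 1, with value [-1/2]. *)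
Definition ln_ratio (R : realType) (x : R) : R :=
  x * (ln x - x + 1) / (x - 1) ^+ 2.

Lemma ln_ratioE (R : realType) (x : R) : 0 < x -> x != 1 ->
  ln x = x - 1 + ln_ratio x * (x + x^-1 - 2).
Proof.
move=> x0 x1; rewrite /ln_ratio; field.
by rewrite subr_eq0 x1 /= ?gt_eqF.
Qed.

(** Controls [ln_ratio] across its singularity: [-1/2] separates the values taken
on the left of 1 from those taken on the right. *)
Lemma ln_ratio_half (R : realType) (x : R) : 0 < x -> x != 1 ->
  0 <= (ln_ratio x + 2^-1) * (1 - x).
Proof.
move=> x0 x1.
have -> : (ln_ratio x + 2^-1) * (1 - x) =
    x * ((x - x^-1 - 2 * ln x) * (x - 1)) / (2 * (x - 1) ^+ 2).
  rewrite /ln_ratio; field.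
  by rewrite subr_eq0 x1 /= ?gt_eqF.
apply: divr_ge0; last by rewrite mulr_ge0 ?sqr_ge0.
apply: mulr_ge0; first exact: ltW.
have f1 : (1 : R) - 1^-1 - 2 * ln 1 = 0 by rewrite ln1 invr1; ring.
have [x1'|/ltW x1'] := leP x 1.
- apply: mulr_le0; last lra.
  by rewrite -f1; apply: ln_sub_inv_ndecr.
- apply: mulr_ge0; last lra.
  by rewrite -f1; apply: ln_sub_inv_ndecr.
Qed.

(** On an interval that avoids 1 the derivative is minus the quotient of
[(z + 1) ln z - 2 (z - 1)] by [(z - 1)^3], two quantities of the same sign.
If 1 separates [x] from [y], then [-1/2] separates their images. *)
Lemma ln_ratio_nincr (R : realType) (x y : R) :
  0 < x -> x != 1 -> y != 1 -> x <= y -> ln_ratio y <= ln_ratio x.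
Proof.
move=> x0 x1 y1 xy.
have y0 : 0 < y := lt_le_trans x0 xy.
have [/andP[xl yg]|side] := boolP ((x < 1) && (1 < y)).
  have := ln_ratio_half x0 x1; rewrite pmulr_lge0 ?subr_gt0 // => hx.
  have := ln_ratio_half y0 y1; rewrite nmulr_lge0 ?subr_lt0 // => hy.
  lra.
rewrite -lerN2.
have f1 : (1 + 1 : R) * ln 1 - 2 * (1 - 1) = 0 by rewrite ln1; ring.
apply: (ge0_is_derive_le (f := fun z => - ln_ratio z)
  (df := fun z => ((z + 1) * ln z - 2 * (z - 1)) / (z - 1) ^+ 3) xy)
  => z /andP[xz zy].
- have z0 : 0 < z := lt_le_trans x0 xz.
  have z1 : z - 1 != 0.
    rewrite subr_eq0; apply/negP => /eqP ez; move: side xz zy.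
    by rewrite ez !lt_neqAle x1 eq_sym y1 /= => /negP side xz zy; rewrite xz zy in side.
  have dln := is_derive1_ln z0.
  have dV : is_derive z 1 (fun y : R => ((y - 1) ^+ 2)^-1)
      (- ((z - 1) ^+ 2) ^- 2 *: (2 * (z - 1))).
    apply: is_deriveV; first by rewrite expf_neq0.
    by apply: is_derive_eq; rewrite /GRing.scale /=; ring.
  rewrite /ln_ratio.
  apply: is_derive_eq.
  rewrite /GRing.scale /=.
  by field; rewrite z1 gt_eqF.
- have z0 : 0 < z := lt_le_trans x0 xz.
  have [zl|zg] := leP z 1.
  + apply: mulr_le0.
      by rewrite -f1; apply: pade_ln_ndecr.
    rewrite invr_le0 exprS mulr_le0_ge0 ?sqr_ge0 //; lra.
  + apply: divr_ge0.
      by rewrite -f1; apply: pade_ln_ndecr => //; exact: ltW.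
    rewrite exprn_ge0 //; lra.
Qed.

(** The difference of the two sides is [ln_ratio u - ln_ratio x] times
[(x - 1)^2 / x], so the monotonicity of [ln_ratio] decides its sign. *)
Lemma ln_le_interpolant (R : realType) (u x : R) : 0 < u -> u != 1 -> u <= x ->
  ln x <= x - 1 + ln_ratio u * (x + x^-1 - 2).
Proof.
move=> u0 u1 ux.
have x0 : 0 < x := lt_le_trans u0 ux.
have [->|x1] := eqVneq x 1; first by rewrite ln1 invr1; lra.
rewrite {1}ln_ratioE // lerD2l ler_wpM2r ?ln_ratio_nincr //.
have -> : x + x^-1 - 2 = (x - 1) ^+ 2 / x by field; rewrite gt_eqF.
by rewrite divr_ge0 ?sqr_ge0 // ltW.
Qed.

Lemma ln_ge_interpolant (R : realType) (u x : R) : 0 < x -> u != 1 -> x <= u ->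
  x - 1 + ln_ratio u * (x + x^-1 - 2) <= ln x.
Proof.
move=> x0 u1 xu.
have [->|x1] := eqVneq x 1; first by rewrite ln1 invr1; lra.
rewrite [leRHS]ln_ratioE // lerD2l ler_wpM2r ?ln_ratio_nincr //.
have -> : x + x^-1 - 2 = (x - 1) ^+ 2 / x by field; rewrite gt_eqF.
by rewrite divr_ge0 ?sqr_ge0 // ltW.
Qed.

(** * Comparison with two-point variables *)

Lemma div_neq1 (F : numFieldType) (u v : F) : 0 < v -> u != v -> u / v != 1.
Proof.
move=> v0; apply: contraNneq => uv1.
by rewrite -[u](divfK (lt0r_neq0 v0)) uv1 mul1r.
Qed.

(** The interpolant that is tangent to [ln] at [v] is a combination of [1], [t]
and [1/t]; hence its mean depends only on the arithmetic and harmonic means. *)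
Lemma sum_interpolant (R : realType) (n : nat) (w x : 'I_n -> R) (v C : R) :
  0 < v -> (forall i, 0 < x i) -> \sum_(i < n) w i = 1 ->
  \sum_(i < n) w i * (ln v + (x i / v - 1
      + C * (x i / v + (x i / v)^-1 - 2)))
  = ln v + ((\sum_(i < n) w i * x i) / v - 1
      + C * ((\sum_(i < n) w i * x i) / v + v * (\sum_(i < n) w i / x i) - 2)).
Proof.
move=> v0 x0 w1.
transitivity (\sum_(i < n) (w i * (ln v - 1 - 2 * C)
    + (w i * x i) * ((1 + C) / v) + (w i / x i) * (C * v))).
  by apply: eq_bigr => i _; field; rewrite !gt_eqF.
rewrite !big_split /= -!mulr_suml w1.
by field; rewrite gt_eqF.
Qed.

(** The same mean for the variable with values [u] and [v]: there the interpolant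
coincides with [ln]. *)
Lemma two_point_interpolant (R : realType) (p u v : R) : 0 < u -> 0 < v -> u != v ->
  p * ln u + (1 - p) * ln v =
  ln v + ((p * u + (1 - p) * v) / v - 1 + ln_ratio (u / v)
    * ((p * u + (1 - p) * v) / v + v * (p / u + (1 - p) / v) - 2)).
Proof.
move=> u0 v0 uv.
have q0 : 0 < u / v by rewrite divr_gt0.
have q1 : u / v != 1 by exact: div_neq1.
have -> : ln u = ln v + ln (u / v) by rewrite ln_div ?posrE //; ring.
rewrite (ln_ratioE q0 q1).
by field; rewrite !gt_eqF.
Qed.

(** Every value lies to the right of [u], where [ln] is below the interpolant; the
mean of the interpolant is the same for [x] as for the two-point variable. *)
Lemma sum_ln_le_two_point (R : realType) (n : nat) (w x : 'I_n -> R) (p u v : R) :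
  (forall i, 0 < w i) -> (forall i, 0 < x i) -> \sum_(i < n) w i = 1 ->
  0 < u -> 0 < v -> u != v ->
  \sum_(i < n) w i * x i = p * u + (1 - p) * v ->
  \sum_(i < n) w i / x i = p / u + (1 - p) / v ->
  (forall i, u <= x i) ->
  \sum_(i < n) w i * ln (x i) <= p * ln u + (1 - p) * ln v.
Proof.
move=> w0 x0 w1 u0 v0 uv mean invmean ux.
rewrite two_point_interpolant // -mean -invmean -sum_interpolant //.
apply: ler_sum => i _; rewrite ler_pM2l //.
have -> : ln (x i) = ln v + ln (x i / v) by rewrite ln_div ?posrE //; ring.
rewrite lerD2l; apply: ln_le_interpolant; first exact: divr_gt0.
  exact: div_neq1.
by rewrite ler_pM2r ?invr_gt0.
Qed.

Lemma sum_ln_ge_two_point (R : realType) (n : nat) (w x : 'I_n -> R) (p u v : R) :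
  (forall i, 0 < w i) -> (forall i, 0 < x i) -> \sum_(i < n) w i = 1 ->
  0 < u -> 0 < v -> u != v ->
  \sum_(i < n) w i * x i = p * u + (1 - p) * v ->
  \sum_(i < n) w i / x i = p / u + (1 - p) / v ->
  (forall i, x i <= u) ->
  p * ln u + (1 - p) * ln v <= \sum_(i < n) w i * ln (x i).
Proof.
move=> w0 x0 w1 u0 v0 uv mean invmean ux.
rewrite two_point_interpolant // -mean -invmean -sum_interpolant //.
apply: ler_sum => i _; rewrite ler_pM2l //.
have -> : ln (x i) = ln v + ln (x i / v) by rewrite ln_div ?posrE //; ring.
rewrite lerD2l; apply: ln_ge_interpolant; first exact: divr_gt0.
  exact: div_neq1.
by rewrite ler_pM2r ?invr_gt0.
Qed.

(** * The spread of weighted values *)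

(** Cauchy-Schwarz: the quadratic [A - 2 k S + k^2 H] is the sum of the
nonnegative terms [(w i / x i) (x i - k)^2], and it is evaluated at its
minimum [k = S / H]. *)
Lemma sqr_sum_le_mul_sums (R : realType) (I : finType) (P : pred I) (w x : I -> R) :
  (forall i, 0 <= w i) -> (forall i, 0 < x i) ->
  (\sum_(i | P i) w i) ^+ 2
  <= (\sum_(i | P i) w i * x i) * (\sum_(i | P i) w i / x i).
Proof.
move=> w0 x0.
set S := \sum_(i | P i) w i; set A := \sum_(i | P i) w i * x i.
set H := \sum_(i | P i) w i / x i.
have quad k : 0 <= A - 2 * k * S + k ^+ 2 * H.
  have -> : A - 2 * k * S + k ^+ 2 * H =
      \sum_(i | P i) w i / x i * (x i - k) ^+ 2.
    rewrite /A /S /H !mulr_sumr -sumrN -!big_split /=; apply: eq_bigr => i _.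
    by field; rewrite gt_eqF.
  by apply: sumr_ge0 => i _; rewrite mulr_ge0 ?sqr_ge0 // divr_ge0 // ltW.
have H0 : 0 <= H by apply: sumr_ge0 => i _; rewrite divr_ge0 // ltW.
have [Hz|Hn] := eqVneq H 0.
  suff -> : S = 0 by rewrite expr0n /= Hz mulr0.
  apply: big1 => i Pi.
  have /eqP : w i / x i = 0.
    by apply: (psumr_eq0P _ Hz) => // j _; rewrite divr_ge0 // ltW.
  by rewrite mulf_eq0 invr_eq0 (gt_eqF (x0 i)) orbF => /eqP.
have := quad (S / H); rewrite -(pmulr_lge0 _ (_ : 0 < H)) ?lt_def ?Hn //.
have -> : (A - 2 * (S / H) * S + (S / H) ^+ 2 * H) * H = A * H - S ^+ 2.
  by field.
by rewrite subr_ge0.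
Qed.

(** Cauchy-Schwarz for the indices other than [i], whose weights, first moments
and inverse moments are [1 - w i], [a - w i * x i] and [b - w i / x i], with
[a] and [b] the moments of the whole family. *)
Lemma value_dispersion_le (R : realType) (n : nat) (w x : 'I_n -> R)
    (i : 'I_n) :
  (forall i, 0 < w i) -> (forall i, 0 < x i) -> \sum_(i < n) w i = 1 ->
  w i * (x i * (\sum_(j < n) w j / x j) + (\sum_(j < n) w j * x j) / x i - 2)
  <= (\sum_(j < n) w j * x j) * (\sum_(j < n) w j / x j) - 1.
Proof.
move=> w0 x0 w1; set b := \sum_(j < n) w j / x j; set a := \sum_(j < n) _.
have := sqr_sum_le_mul_sums (fun j => j != i)
  (fun j => ltW (w0 j)) x0.
have -> : \sum_(j | j != i) w j = 1 - w i.
  by rewrite -w1 [in RHS](bigD1 i) //=; ring.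
have -> : \sum_(j | j != i) w j * x j = a - w i * x i.
  by rewrite /a [in RHS](bigD1 i) //=; ring.
have -> : \sum_(j | j != i) w j / x j = b - w i / x i.
  by rewrite /b [in RHS](bigD1 i) //=; ring.
rewrite -subr_ge0 -[in X in _ -> X]subr_ge0.
congr (is_true (0 <= _)).
by field; rewrite gt_eqF.
Qed.

(** The difference of the means is the mean of [(x i - h)^2 / x i], where [h] is
the harmonic mean; it vanishes only if every [x i] equals [h]. *)
Lemma harmonic_lt_arithmetic (R : realType) (n : nat) (w x : 'I_n -> R) :
  (forall i, 0 < w i) -> (forall i, 0 < x i) -> \sum_(i < n) w i = 1 ->
  ~ (forall i j, x i = x j) ->
  (\sum_(i < n) w i / x i)^-1 < \sum_(i < n) w i * x i.
Proof.
move=> w0 x0 w1 xnc; set b := \sum_(i < n) w i / x i; set a := \sum_(i < n) _.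
have t0 i : 0 <= w i / x i by rewrite divr_ge0 // ltW.
have b0 : b != 0.
  apply/negP => /eqP bz; apply: xnc => i j.
  have /eqP : w i / x i = 0 by apply: (psumr_eq0P _ bz).
  by rewrite mulf_eq0 invr_eq0 !gt_eqF.
have var : a - b^-1 = \sum_(i < n) w i / x i * (x i - b^-1) ^+ 2.
  transitivity (\sum_(i < n) (w i * x i - w i * (2 * b^-1) + w i / x i * b ^- 2)).
    rewrite !big_split /= sumrN -!mulr_suml w1 -/a -/b.
    by field; rewrite b0.
  by apply: eq_bigr => i _; field; rewrite ?b0 ?gt_eqF ?andbT.
have term0 i : 0 <= w i / x i * (x i - b^-1) ^+ 2.
  by rewrite mulr_ge0 ?sqr_ge0.
rewrite -subr_gt0 var lt_def sumr_ge0 ?andbT //.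
apply/negP => /eqP sz; apply: xnc.
suff xb i : x i = b^-1 by move=> i j; rewrite !xb.
have /eqP : w i / x i * (x i - b^-1) ^+ 2 = 0 by apply: (psumr_eq0P _ sz).
rewrite mulf_eq0 mulf_eq0 invr_eq0 (gt_eqF (w0 i)) (gt_eqF (x0 i)) /=.
by rewrite sqrf_eq0 subr_eq0 => /eqP.
Qed.

(** * The two extremal variables *)

(** The sign of [s] is left open, so that both two-point variables are covered.
The conditions on the moments amount to a quadratic equation for [u], whose
discriminant is [s ^+ 2]. Positivity of [u] and [v] holds
because [s ^+ 2] is smaller than the square of the rest of each numerator, by
[a h (2 p)^2] and [a h (2 (1 - p))^2]. If [u = v], then
[s = - (1 - 2 p) (a - h)], and squaring gives [4 p (1 - p) a (a - h) = 0]. *)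
Lemma two_point_spec (R : rcfType) (a h p s : R) :
  0 < p -> p <= 2^-1 -> 0 < h -> h < a ->
  s ^+ 2 = (a - h) * (a - h * (1 - 2 * p) ^+ 2) ->
  let u := (a - h * (1 - 2 * p) + s) / (2 * p) in
  let v := (a + h * (1 - 2 * p) - s) / (2 * (1 - p)) in
  [/\ 0 < u, 0 < v, u != v, a = p * u + (1 - p) * v
    & h^-1 = p / u + (1 - p) / v].
Proof.
move=> p0 p2 h0 ha s2.
have a0 : 0 < a := lt_trans h0 ha.
have q0 : 0 < 1 - p by lra.
have hc : h * (1 - 2 * p) <= h by nra.
have hc0 : 0 <= h * (1 - 2 * p) by rewrite mulr_ge0 //; lra.
have sqr_bound y : 0 < y -> s ^+ 2 < y ^+ 2 -> - y < s < y.
  move=> y0 sy; rewrite -ltr_norml -(gtr0_norm y0).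
  by rewrite -!sqrtr_sqr; rewrite ltr_sqrt // exprn_gt0.
have ah0 : 0 < a * h by rewrite mulr_gt0.
have /andP[su _] : - (a - h * (1 - 2 * p)) < s < a - h * (1 - 2 * p).
  apply: sqr_bound; first lra.
  rewrite -subr_gt0 s2.
  have -> : (a - h * (1 - 2 * p)) ^+ 2 - (a - h) * (a - h * (1 - 2 * p) ^+ 2)
     = a * h * (2 * p) ^+ 2 by ring.
  by rewrite mulr_gt0 // exprn_gt0 // mulr_gt0.
have /andP[_ sv] : - (a + h * (1 - 2 * p)) < s < a + h * (1 - 2 * p).
  apply: sqr_bound; first lra.
  rewrite -subr_gt0 s2.
  have -> : (a + h * (1 - 2 * p)) ^+ 2 - (a - h) * (a - h * (1 - 2 * p) ^+ 2)
     = a * h * (2 * (1 - p)) ^+ 2 by ring.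
  by rewrite mulr_gt0 // exprn_gt0 // mulr_gt0.
have nu0 : 0 < a - h * (1 - 2 * p) + s by lra.
have nv0 : 0 < a + h * (1 - 2 * p) - s by lra.
move=> u v.
have u0 : 0 < u by rewrite divr_gt0 // mulr_gt0.
have v0 : 0 < v by rewrite divr_gt0 // mulr_gt0.
split=> //.
- apply/negP => /eqP uv.
  have sE : s = - ((1 - 2 * p) * (a - h)).
    have /eqP : (u - v) * (2 * p * (1 - p)) = 0 by rewrite uv subrr mul0r.
    have -> : (u - v) * (2 * p * (1 - p)) = s + (1 - 2 * p) * (a - h).
      by rewrite /u /v; field; rewrite !gt_eqF.
    by rewrite addr_eq0 => /eqP.
  have gap : (a - h) * a * (4 * p * (1 - p)) = 0.
    apply/eqP; rewrite -(subr_eq0 _ 0) subr0.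
    have -> : (a - h) * a * (4 * p * (1 - p))
      = (a - h) * (a - h * (1 - 2 * p) ^+ 2) - ((1 - 2 * p) * (a - h)) ^+ 2.
      by ring.
    by rewrite -s2 sE sqrrN subrr.
  have : 0 < (a - h) * a * (4 * p * (1 - p)).
    by rewrite !mulr_gt0 // subr_gt0.
  by rewrite gap ltxx.
- by rewrite /u /v; field; rewrite !gt_eqF.
- apply/eqP; rewrite -subr_eq0.
  have -> : h^-1 - (p / u + (1 - p) / v)
      = (u * v - h * (p * v + (1 - p) * u)) / (h * u * v).
    by field; rewrite !gt_eqF.
  have -> : u * v - h * (p * v + (1 - p) * u)
      = ((a - h) * (a - h * (1 - 2 * p) ^+ 2) - s ^+ 2) / (4 * p * (1 - p)).
    by rewrite /u /v; field; rewrite !gt_eqF.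
  by rewrite s2 subrr !mul0r.
Qed.

(** Multiplied by [t h], the hypothesis is a quadratic inequality in [t];
completing the square turns it into [(2 p t - (a - h (1 - 2 p)))^2 <= s^2]. *)
Lemma value_between_roots (R : rcfType) (a h p s t : R) :
  0 < p -> 0 < h -> 0 <= s ->
  s ^+ 2 = (a - h) * (a - h * (1 - 2 * p) ^+ 2) ->
  0 < t -> p * (t * h^-1 + a / t - 2) <= a * h^-1 - 1 ->
  (a - h * (1 - 2 * p) - s) / (2 * p) <= t
    <= (a - h * (1 - 2 * p) + s) / (2 * p).
Proof.
move=> p0 h0 s0 s2 t0 spread.
have : `|2 * p * t - (a - h * (1 - 2 * p))| <= s.
  rewrite -[leRHS](ger0_norm s0) -!sqrtr_sqr ler_wsqrtr // -subr_ge0 s2.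
  have -> : (a - h) * (a - h * (1 - 2 * p) ^+ 2)
      - (2 * p * t - (a - h * (1 - 2 * p))) ^+ 2
    = 4 * p * h * t * ((a * h^-1 - 1) - p * (t * h^-1 + a / t - 2)).
    by field; rewrite !gt_eqF.
  by rewrite mulr_ge0 ?subr_ge0 // ltW // !mulr_gt0.
rewrite ler_norml => /andP[lo hi].
have p20 : 0 < 2 * p by rewrite mulr_gt0.
by rewrite ler_pdivrMr // ler_pdivlMr //; apply/andP; split; lra.
Qed.

Lemma prod_powR_expR (R : realType) (n : nat) (w x : 'I_n -> R) :
  (forall i, 0 < x i) ->
  \prod_(i < n) x i `^ w i = expR (\sum_(i < n) w i * ln (x i)).
Proof.
move=> x0; rewrite expR_sum; apply: eq_bigr => i _.
by rewrite /powR gt_eqF.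
Qed.

Lemma min_weight_le (R : realType) (n : nat) (w : 'I_n -> R) (p : R) :
  (0 < n)%N -> \sum_(i < n) w i = 1 -> (forall i, p <= w i) -> p <= 1 / n%:R.
Proof.
move=> n0 w1 pw; rewrite ler_pdivlMr ?ltr0n // mulr_natr -w1.
have -> : p *+ n = \sum_(i < n) p by rewrite sumr_const card_ord.
exact: ler_sum.
Qed.

Theorem corollary2p1 (R : realType) (n : nat) (w x : 'I_n -> R) (alpha : R)
    (w_gt0 : forall i, 0 < w i)
    (x_gt0 : forall i, 0 < x i)
    (sum_w : \sum_(i < n) w i = 1)
    (x_not_const : ~ (forall i j, x i = x j))
    (alpha_min : is_min w alpha) :
  let h := (\sum_(i < n) w i / x i)^-1 in
  let g := \prod_(i < n) (x i `^ w i) in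
  let a := \sum_(i < n) w i * x i in
  let s := Num.sqrt ((a - h) * (a - h * (1 - 2 * alpha) ^+ 2)) in
  [/\ alpha <= 1 / n%:R,
      g <= ((a - h * (1 - 2 * alpha) - s) / (2 * alpha)) `^ alpha
           * ((a + h * (1 - 2 * alpha) + s) / (2 * (1 - alpha))) `^ (1 - alpha)
    & g >= ((a - h * (1 - 2 * alpha) + s) / (2 * alpha)) `^ alpha
           * ((a + h * (1 - 2 * alpha) - s) / (2 * (1 - alpha))) `^ (1 - alpha)].
Proof.
move=> h g a s.
have [[k wk] le_w] := alpha_min.
have p0 : 0 < alpha by rewrite -wk.
have n2 : (1 < n)%N.
  rewrite ltnNge; apply/negP => n1; apply: x_not_const => i j.
  have i0 (l : 'I_n) : l = 0%N :> nat.
    by apply/eqP; rewrite -leqn0 -ltnS (leq_trans (ltn_ord l)).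
  by congr x; apply: val_inj; rewrite /= !i0.
have pn : alpha <= 1 / n%:R.
  by apply: (min_weight_le _ sum_w le_w); exact: ltnW.
have p2 : alpha <= 2^-1.
  by apply: (le_trans pn); rewrite div1r lef_pV2 ?posrE ?ltr0n ?ler_nat // ltnW.
have ha : h < a by apply: harmonic_lt_arithmetic.
have h0 : 0 < h.
  rewrite invr_gt0 (bigD1 k) //= ltr_pwDl ?divr_gt0 //.
  by apply: sumr_ge0 => i _; rewrite divr_ge0 ?ltW.
have hV : \sum_(i < n) w i / x i = h^-1 by rewrite invrK.
have s2 : s ^+ 2 = (a - h) * (a - h * (1 - 2 * alpha) ^+ 2).
  rewrite sqr_sqrtr //; apply: mulr_ge0; rewrite subr_ge0; first exact: ltW.
  apply: le_trans (ltW ha); rewrite ler_piMr ?(ltW h0) //.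
  by rewrite exprn_ile1 //; lra.
have between i : (a - h * (1 - 2 * alpha) - s) / (2 * alpha) <= x i
    <= (a - h * (1 - 2 * alpha) + s) / (2 * alpha).
  apply: value_between_roots => //; first exact: sqrtr_ge0.
  rewrite -hV; apply: le_trans (value_dispersion_le i w_gt0 x_gt0 sum_w).
  (* The bracket is nonnegative, so the weight [w i] may be lowered to [alpha]. *)
  rewrite ler_wpM2r // hV -/a.
  have -> : x i * h^-1 + a / x i - 2
      = ((x i - h) ^+ 2 + (a - h) * h) / (x i * h).
    by field; rewrite !gt_eqF.
  by rewrite divr_ge0 ?addr_ge0 ?sqr_ge0 // mulr_ge0 ?subr_ge0 ?ltW.
have sN2 : (- s) ^+ 2 = (a - h) * (a - h * (1 - 2 * alpha) ^+ 2).
  by rewrite sqrrN.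
split=> //.
- have [] := two_point_spec p0 p2 h0 ha sN2; rewrite opprK.
  set u := _ / _; set v := _ / _ => u0 v0 uv aE hE.
  rewrite /g prod_powR_expR // /powR !gt_eqF // -expRD ler_expR.
  apply: sum_ln_le_two_point => //; first by rewrite hV.
  by move=> i; case/andP: (between i).
- have [] := two_point_spec p0 p2 h0 ha s2.
  set u := _ / _; set v := _ / _ => u0 v0 uv aE hE.
  rewrite /g prod_powR_expR // /powR !gt_eqF // -expRD ler_expR.
  apply: sum_ln_ge_two_point => //; first by rewrite hV.
  by move=> i; case/andP: (between i).
Qed.
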